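(* Let $T$ be a $k$-regular tree and let $\phi:VT\to\mathcal{A}$ be a coloring. The following are equivalent. (1) The coloring $\phi$ is periodic. (2) The subword complexity of $\phi$ satisfies $b_\phi(n+1)=b_\phi(n)$ for some $n>0$. (3) The subword complexity $b_\phi(n)$ is bounded.
   Context: $T$ is a $k$-regular tree, i.e. a tree without terminal vertices in which every vertex has exactly $k$ edges issuing from it; $VT$ is its vertex set, and $G=\mathrm{Aut}(T)$ is its group of automorphisms. $\mathcal{A}$ is a countable set (the alphabet), and a coloring is any map $\phi:VT\to\mathcal{A}$. With $d$ the length metric on $T$ in which all edges have length $1$, $B_n(x)$ is the ball of radius $n$ around the vertex $x$, consisting of the vertices and edges of $T$ within distance $n$ of $x$. Two balls $B_n(x)$ and $B_n(y)$ are equivalent if there is a color-preserving isomorphism from $B_n(x)$ to $B_n(y)$; the equivalence class is denoted $[B_n(x)]$ and called a colored $n$-ball. The subword complexity $b_\phi(n)$ is the cardinality of the set of colored $n$-balls $[B_n(x)]$, $x\in VT$, that appear in $T$ colored by $\phi$. The coloring $\phi$ is periodic if there is a subgroup $\Gamma\subset G$ (not required to be discrete) such that $\Gamma\backslash T$ is a finite graph and $\phi$ is $\Gamma$-invariant, i.e. $\phi(\gamma x)=\phi(x)$ for all $x\in VT$ and $\gamma\in\Gamma$.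
   Formalization: In (2) the equal values b_φ(n+1)=b_φ(n) are required to be finite: for an infinite alphabet an injective coloring has b_φ(n) infinite for every n, so (2) would hold for a non-periodic coloring. *)

(* Defs.v *)
From HB Require Import structures.
From mathcomp Require Import all_boot.
From mathcomp Require Import boolp classical_sets functions cardinality.

Set Implicit Arguments.
Unset Strict Implicit.
Unset Printing Implicit Defensive.

Local Open Scope classical_set_scope.
Local Open Scope card_scope.

(* A tree is given by its vertex type V and its adjacency relation e. It has  *)
(* no loops or multiple edges, so the edges issuing from x correspond to the  *)
(* neighbours of x.                                                           *)
Definition tree (V : eqType) (e : rel V) : Prop :=
  [/\ inhabited V,
      symmetric e /\ irreflexive e,
      forall x y, exists2 p, path e x p & last x p = y
    & forall c : seq V, ucycle e c -> (size c < 3)%N].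

Definition degree_is (V : eqType) (e : rel V) (x : V) (d : nat) : Prop :=
  [set y | e x y] #= `I_d.

Definition terminal (V : eqType) (e : rel V) (x : V) : Prop :=
  degree_is e x 1.

Definition regular_tree (k : nat) (V : eqType) (e : rel V) : Prop :=
  [/\ tree e, forall x, ~ terminal e x & forall x, degree_is e x k].

Definition path_lengths (V : eqType) (e : rel V) (x y : V) : set nat :=
  [set size p | p in [set p | path e x p /\ last x p = y]].

(* The default value 0 is irrelevant when e is connected.                     *)
Definition dist (V : eqType) (e : rel V) (x y : V) : nat :=
  xget 0%N [set d | path_lengths e x y d /\
                    forall d', path_lengths e x y d' -> (d <= d')%N].

(* In a tree, the edges within distance n of x are exactly those with both    *)
(* ends in this set (adjacent vertices have distinct distances to x), so the  *)
(* ball as a graph is the subgraph induced on it.                             *)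
Definition ball (V : eqType) (e : rel V) (n : nat) (x : V) : set V :=
  [set y | (dist e x y <= n)%N].

(* Only the values of f on the ball around x matter; f is not required to     *)
(* send x to y.                                                               *)
Definition ball_equiv (V : eqType) (A : Type) (e : rel V) (phi : V -> A)
    (n : nat) (x y : V) : Prop :=
  exists f : V -> V,
    [/\ set_bij (ball e n x) (ball e n y) f,
        forall u v, ball e n x u -> ball e n x v -> e (f u) (f v) = e u v
      & forall u, ball e n x u -> phi (f u) = phi u].

(* [B_n(x)], represented by the set of centres of the balls in the class.     *)
Definition colored_ball (V : eqType) (A : Type) (e : rel V) (phi : V -> A)
    (n : nat) (x : V) : set V :=
  [set y | ball_equiv e phi n x y].

(* b_phi(n) = m. For an infinite alphabet there may be no such natural number *)
(* m; equality and boundedness of b_phi are meant between natural numbers.    *)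
Definition subword_complexity_is (V : eqType) (A : Type) (e : rel V)
    (phi : V -> A) (n m : nat) : Prop :=
  range (colored_ball e phi n) #= `I_m.

Definition automorphism (V : eqType) (e : rel V) (g : V -> V) : Prop :=
  bijective g /\ forall x y, e (g x) (g y) = e x y.

(* Subgroups of Aut(T) as sets of maps on vertices; cancel g h says that h is *)
(* the inverse of the bijection g.                                            *)
Definition aut_subgroup (V : eqType) (e : rel V) (Gamma : set (V -> V)) :
    Prop :=
  [/\ forall g, Gamma g -> automorphism e g,
      Gamma idfun,
      forall g h, Gamma g -> Gamma h -> Gamma (g \o h)
    & forall g h, Gamma g -> cancel g h -> Gamma h].

Definition edges (V : eqType) (e : rel V) : set (set V) :=
  [set E | exists x y, e x y /\ E = [set x; y]].

Definition vertex_orbit (V : Type) (Gamma : set (V -> V)) (x : V) : set V :=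
  [set g x | g in Gamma].

Definition edge_orbit (V : Type) (Gamma : set (V -> V)) (E : set V) :
    set (set V) :=
  [set g @` E | g in Gamma].

Definition finite_quotient (V : eqType) (e : rel V) (Gamma : set (V -> V)) :
    Prop :=
  finite_set (range (vertex_orbit Gamma)) /\
  finite_set (edge_orbit Gamma @` edges e).

Definition periodic (V : eqType) (A : Type) (e : rel V) (phi : V -> A) :
    Prop :=
  exists Gamma : set (V -> V),
    [/\ aut_subgroup e Gamma,
        finite_quotient e Gamma
      & forall g x, Gamma g -> phi (g x) = phi x].

(* Main.v *)
(* The number of colored n-balls is nondecreasing in n, because an isomorphism
   of balls of radius n+1 preserves the centres (there are no terminal
   vertices) and so restricts to the balls of radius n; if phi is periodic it
   is bounded by the number of vertex orbits. Suppose that it takes the same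
   value at n and n+1. Then [B_n(x)] determines [B_(n+1)(x)], hence the
   multiset of the [B_n(x')] with x' adjacent to x. So if [B_n(x)] = [B_n(y)],
   an automorphism sending x to y can be built outwards from x one edge at a
   time, preserving [B_n(.)] and thus phi, and the orbits of the group of phi-
   preserving automorphisms are as few as the colored n-balls. *)

Require Import Defs.
From mathcomp Require Import all_boot.
From mathcomp Require Import zify.
From mathcomp Require Import boolp classical_sets functions cardinality.

Set Implicit Arguments.
Unset Strict Implicit.
Unset Printing Implicit Defensive.

Local Open Scope classical_set_scope.
Local Open Scope card_scope.

(** * Simple paths and distances in a tree *)

Section Tree.
Variables (V : eqType) (e : rel V).
Hypothesis hT : tree e.

Lemma tree_sym : symmetric e.
Proof. by case: hT => _ []. Qed.

Lemma tree_irr : irreflexive e.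
Proof. by case: hT => _ []. Qed.

(* At p = [::] the side condition says v != x. *)
Lemma cons_upath x p v :
  path e x p -> uniq (x :: p) -> e x v -> v != head x p -> v \notin x :: p.
Proof.
move=> pxp uxp exv vh.
have vx : v != x by apply: contraTneq exv => ->; rewrite tree_irr.
rewrite inE negb_or vx; apply/negP => vp.
case/splitPr: vp pxp uxp vh => -[|a p1] p2; first by rewrite /= eqxx.
rewrite -cat_rcons cat_path -cat_cons cat_uniq => /andP[pc _] /andP[uc _] _.
(* If [v] lay on the path beyond its second vertex [a], the edge from [v] to [x] would close the
   segment [x], [a], ..., [v] to a cycle with at least three vertices. *)
have [_ _ _ /(_ (x :: rcons (a :: p1) v))] := hT.
rewrite /ucycle (cycle_path x) /= last_rcons tree_sym exv size_rcons.
move: uc pc; rewrite !rcons_cons /= => -> pc.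
by rewrite andbT => /(_ pc).
Qed.

Lemma upath_unique x p q :
  path e x p -> uniq (x :: p) -> path e x q -> uniq (x :: q) ->
  last x p = last x q -> p = q.
Proof.
elim: q x p => [|v q IHq] x [|u p] //.
- by move=> _ /= /andP[xp _] _ _ lx; rewrite -lx mem_last in xp.
- by move=> _ _ _ /= /andP[xq _] lx; rewrite lx mem_last in xq.
move=> pp up pq uq l; have [uv|uv] := eqVneq u v.
  subst v; congr (_ :: _); apply: (IHq u) => //.
  - by case/andP: pp.
  - by case/andP: up.
  - by case/andP: pq.
  - by case/andP: uq.
have exv : e x v by case/andP: pq.
have vn : v \notin x :: u :: p by apply: cons_upath => //=; rewrite eq_sym.
(* If the first steps differ, prepending [v] to the other path gives a second simple path from [v]
   to the same end. By induction it is [q], which would then pass through [x]. *)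
suff E : x :: u :: p = q by move: uq; rewrite -E /= !inE eqxx orbT.
apply: (IHq v) => //.
- by rewrite [path _ _ _]/= tree_sym exv.
- by rewrite cons_uniq vn.
- by case/andP: pq.
- by case/andP: uq.
Qed.

Lemma dist_spec x y : path_lengths e x y (dist e x y) /\
  forall d, path_lengths e x y d -> (dist e x y <= d)%N.
Proof.
rewrite /dist; case: xgetP => [d -> //|].
have ex : exists d, `[< path_lengths e x y d >].
  have [_ _ /(_ x y)[p pp lp] _] := hT.
  by exists (size p); apply/asboolP; exists p.
case: (ex_minnP ex) => d /asboolP dP dmin /(_ d) [].
by split=> // d' d'P; apply: dmin; apply/asboolP.
Qed.

Lemma dist_leP x y n : (dist e x y <= n)%N <->
  exists p, [/\ path e x p, last x p = y & (size p <= n)%N].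
Proof.
have [[p [pp lp] sp] dmin] := dist_spec x y.
split=> [le_n|[q [pq lq le_n]]]; first by exists p; rewrite sp.
by apply: leq_trans le_n; apply: dmin; exists q.
Qed.

Lemma dist_upath x p :
  path e x p -> uniq (x :: p) -> dist e x (last x p) = size p.
Proof.
move=> pp up; apply/eqP; rewrite eqn_leq; apply/andP; split.
  by apply/dist_leP; exists p.
have [[q [pq lq] <-] _] := dist_spec x (last x p).
move: lq; case/shortenP: pq => q' pq' uq' sq' lq.
by rewrite (upath_unique pp up pq' uq') ?uniq_leq_size //; case/andP: uq'.
Qed.

Lemma dist_xx x : dist e x x = 0%N.
Proof. by apply/eqP; rewrite -leqn0; apply/dist_leP; exists [::]. Qed.

Lemma dist_adj x y : e x y -> (dist e x y <= 1)%N.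
Proof. by move=> exy; apply/dist_leP; exists [:: y]; rewrite /= exy. Qed.

Lemma dist_triangle y x z : (dist e x z <= dist e x y + dist e y z)%N.
Proof.
have [[p [pp lp] <-] _] := dist_spec x y.
have [[q [pq lq] <-] _] := dist_spec y z.
by apply/dist_leP; exists (p ++ q); rewrite cat_path pp last_cat lp pq size_cat.
Qed.

Lemma ball_centre n x : ball e n x x.
Proof. by rewrite /ball /= dist_xx. Qed.

(** A walk of length at most [n] from [u] stays in the ball of radius [N] around [x], so [f] carries
    it edge by edge to a walk of the same length. *)
Lemma hom_ball_dist (f : V -> V) N x u w n :
  (forall a b, ball e N x a -> ball e N x b -> e a b -> e (f a) (f b)) ->
  (dist e x u + n <= N)%N -> (dist e u w <= n)%N ->
  ball e N x w /\ (dist e (f u) (f w) <= n)%N.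
Proof.
move=> fe xuN /dist_leP[p [pp <- sp]].
elim: p u n xuN pp sp => [|v p IHp] u n xuN /=.
  by move=> _ _; rewrite dist_xx /ball /=; split=> //; lia.
case: n xuN => // n xuN /andP[euv pp] sp.
have uv := dist_adj euv; have xv := dist_triangle u x v.
have [|//|xw fvw] := IHp v n _ pp; try lia; split=> //.
have fuv : (dist e (f u) (f v) <= 1)%N.
  by apply/dist_adj/fe => //; rewrite /ball /=; lia.
by have := dist_triangle (f v) (f u) (f (last v p)); lia.
Qed.


Lemma dist_sym x y : dist e x y = dist e y x.
Proof.
suff le a b : (dist e a b <= dist e b a)%N by apply/eqP; rewrite eqn_leq !le.
have [[p [pp lp] <-] _] := dist_spec b a; apply/dist_leP.
exists (rev (belast b p)); split; last by rewrite size_rev size_belast.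
  by rewrite -lp rev_path; under eq_path => u v do rewrite tree_sym.
by case: p lp {pp} => [//|c p _]; rewrite /= rev_cons last_rcons.
Qed.

(** * Consequences of the absence of terminal vertices: a ball determines its centre *)

Hypothesis hN : forall x, ~ terminal e x.

Lemma other_neighbour x a : e x a -> exists2 b, e x b & b != a.
Proof.
move=> exa; apply: contrapT => nb; apply: (hN (x := x)).
rewrite /terminal /degree_is (_ : [set y | e x y] = [set a]) ?card_set1 //.
apply/seteqP; split=> [b exb|_ ->] //=.
by apply: contrapT => /eqP ba; apply: nb; exists b.
Qed.

(** The path is prolonged backwards beyond its start: the current first vertex always has a
    neighbour other than the next vertex of the path. *)
Lemma extend_upath x p n : path e x p -> uniq (x :: p) -> p != [::] ->
  exists z q, [/\ path e z q, uniq (z :: q), last z q = last x p,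
    size q = (size p + n)%N & (dist e z x <= n)%N].
Proof.
move=> pp up p0; elim: n => [|n [z [q [pq uq lq sq zx]]]].
  by exists x, p; rewrite addn0 dist_xx.
case: q pq uq lq sq => [|a q] pq uq lq sq.
  by case: p p0 sq {pp up lq}.
have [b ezb ba] : exists2 b, e z b & b != a.
  by apply: other_neighbour; case/andP: pq.
have ebz : e b z by rewrite tree_sym.
have bq : b \notin z :: a :: q by apply: cons_upath.
exists b, (z :: a :: q); split=> //.
- by rewrite [path _ _ _]/= ebz.
- by rewrite cons_uniq bq.
- by move: sq => /= ->; rewrite addnS.
- by have := dist_triangle z b x; have := dist_adj ebz; lia.
Qed.

(** If the centres differed, walking [n] steps from [y] away from [x] would reach a vertex of the
    ball around [y] at distance [n + dist e x y] from [x]. *)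
Lemma ball_sub_eq n x y : ball e n y `<=` ball e n x -> x = y.
Proof.
move=> sub; apply: contrapT => xy.
have [_ _ /(_ y x)[p pp lp] _] := hT.
move: lp; case/shortenP: pp => p' pp up _ lp.
have p0 : p' != [::] by apply/eqP => E; apply: xy; rewrite -lp E.
have [z [q [pq uq lq sq zy]]] := extend_upath n pp up p0.
have := dist_upath pq uq; rewrite lq lp dist_sym sq.
have := sub z; rewrite /ball /= dist_sym => /(_ zy).
by case: p' p0 {pp up lp lq sq} => //= *; lia.
Qed.

(** * Color-preserving isomorphisms of balls *)

Section Colouring.
Variables (A : Type) (phi : V -> A).

(** One half of an isomorphism of balls; the other half exchanges [f] with [g] and [x] with [y].
    With the inverse explicit, symmetry and composition become formal. *)
Definition ball_map n (f g : V -> V) x y : Prop :=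
  (forall u, ball e n x u ->
     [/\ ball e n y (f u), phi (f u) = phi u & g (f u) = u]) /\
  (forall u v, ball e n x u -> ball e n x v -> e u v -> e (f u) (f v)).

Lemma ball_equivP n x y : ball_equiv e phi n x y <->
  exists f g, ball_map n f g x y /\ ball_map n g f y x.
Proof.
split=> [[f [[f1 f2 f3] fe fphi]]|[f [g [[f1 fe] [g1 ge]]]]].
  (* [g] inverts [f] on the ball around [y]; its values elsewhere do not matter. *)
  have [v|g gP] := choice (X := V) (Y := V)
      (P := fun v u => ball e n y v -> ball e n x u /\ f u = v).
    have [/f3[u xu fu]|nv] := pselect (ball e n y v).
      by exists u.
    by exists v.
  have gf u : ball e n x u -> g (f u) = u.
    move=> xu; have [xg fg] := gP _ (f1 _ xu).
    by apply: f2 => //; apply/mem_set.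
  exists f, g; split; split=> u.
  - by move=> xu; split; [exact: f1|exact: fphi|exact: gf].
  - by move=> v xu xv; rewrite fe.
  - by move=> yu; have [xg fg] := gP _ yu; rewrite -[in RHS]fg fphi.
  - move=> v /gP[xu fu] /gP[xv fv] euv; by rewrite -fe // fu fv.
exists f; split.
- split=> [u /f1[]//|u v|v /g1[xg _ fg]]; last by exists (g v).
  by rewrite !inE => /f1[_ _ {2}<-] /f1[_ _ {2}<-] ->.
- move=> u v xu xv; have [[yu _ gu] [yv _ gv]] := (f1 _ xu, f1 _ xv).
  by apply/idP/idP => [/(ge _ _ yu yv)|/(fe _ _ xu xv)//]; rewrite gu gv.
- by move=> u /f1[].
Qed.

Lemma ball_equiv_sym n x y : ball_equiv e phi n x y -> ball_equiv e phi n y x.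
Proof. by move=> /ball_equivP[f [g [fP gP]]]; apply/ball_equivP; exists g, f. Qed.

Lemma ball_map_comp n f g f' g' x y z :
  ball_map n f g x y -> ball_map n f' g' y z ->
  ball_map n (f' \o f) (g \o g') x z.
Proof.
move=> [f1 fe] [f1' fe']; split=> [u /f1[/f1'[? p q] p' q']|u v xu xv euv] /=.
  by rewrite p p' q q'.
by apply: fe' (fe _ _ xu xv euv); [case: (f1 _ xu)|case: (f1 _ xv)].
Qed.

Lemma ball_equiv_trans n x y z :
  ball_equiv e phi n x y -> ball_equiv e phi n y z -> ball_equiv e phi n x z.
Proof.
move=> /ball_equivP[f [g [? ?]]] /ball_equivP[f' [g' [? ?]]].
apply/ball_equivP; exists (f' \o f), (g \o g').
by split; apply: ball_map_comp; eassumption.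
Qed.

Lemma ball_equiv_aut n x g : automorphism e g ->
  (forall u, phi (g u) = phi u) -> ball_equiv e phi n x (g x).
Proof.
move=> [[h gK hK] ge] gphi.
have he u v : e (h u) (h v) = e u v by rewrite -ge !hK.
have le (f : V -> V) u v : (forall a b, e (f a) (f b) = e a b) ->
    (dist e (f u) (f v) <= dist e u v)%N.
  move=> fe; have [[p [pp lp] <-] _] := dist_spec u v.
  apply/dist_leP; exists (map f p); rewrite size_map last_map lp.
  by split=> //; rewrite path_map; rewrite (eq_path (e' := e)).
apply/ball_equivP; exists g, h; split; split=> u; rewrite /ball /=.
- by move=> xu; split=> //; apply: leq_trans xu; apply: le.
- by move=> v _ _; rewrite ge.
- move=> xu; rewrite hK -[in RHS](hK u) gphi; split=> //.
  by apply: leq_trans xu; rewrite -{1}(gK x); apply: le.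
- by move=> v _ _; rewrite he.
Qed.

Lemma colored_ballP n x y :
  colored_ball e phi n x = colored_ball e phi n y <-> ball_equiv e phi n x y.
Proof.
split=> [E|xy].
  have : colored_ball e phi n y y.
    apply: (@ball_equiv_aut n y idfun) => //; split=> //; by exists idfun.
  by rewrite -E.
apply/seteqP; split=> z; rewrite /colored_ball /=; apply: ball_equiv_trans => //.
exact: ball_equiv_sym.
Qed.

(** Each [z] in the ball around [y] is [f (g z)] with [g z] within [n] of [x], hence lies within [n]
    of [f x]. So the ball around [y] is contained in the one around [f x]. *)
Lemma ball_map_centre n f g x y :
  ball_map n f g x y -> ball_map n g f y x -> f x = y.
Proof.
move=> [f1 fe] [g1 _]; apply: (@ball_sub_eq n) => z /g1[xg _ <-].
by have [|//|//] := @hom_ball_dist f n x x (g z) n fe; rewrite dist_xx.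
Qed.

Lemma ball_map_restrict N n f g x y u :
  ball_map N f g x y -> (dist e x u + n <= N)%N -> ball_map n f g u (f u).
Proof.
move=> [f1 fe] xuN; have H w := @hom_ball_dist f N x u w n fe xuN.
split=> [w /H[xw fuw]|v w /H[xv _] /H[xw _]]; last exact: fe.
by have [] := f1 w xw.
Qed.

(** The smaller ball may be off-centre: this lets an isomorphism of radius [n.+1] compare the
    [n]-balls around the neighbours of the centre. *)
Lemma ball_equiv_restrict N n f g x y u :
  ball_map N f g x y -> ball_map N g f y x -> (dist e x u + n <= N)%N ->
  ball_equiv e phi n u (f u).
Proof.
move=> fP gP xuN; apply/ball_equivP; exists f, g; split.
  exact: ball_map_restrict fP xuN.
have xu : ball e N x u by rewrite /ball /=; lia.
have [fu _ {2}<-] := fP.1 _ xu.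
apply: (ball_map_restrict gP).
(* Restricting [g] around [f u] needs [f u] to be no farther from [y] than [u] is from [x]; this
   holds because [f x = y]. *)
have [||_] := @hom_ball_dist f N x x u (dist e x u) fP.2; rewrite ?dist_xx //.
by rewrite (ball_map_centre fP gP); lia.
Qed.

Lemma ball_equiv_pred n x y :
  ball_equiv e phi n.+1 x y -> ball_equiv e phi n x y.
Proof.
move=> /ball_equivP[f [g [fP gP]]]; rewrite -(ball_map_centre fP gP).
by apply: ball_equiv_restrict fP gP _; rewrite dist_xx; lia.
Qed.

Lemma ball_equiv_colour n x y : ball_equiv e phi n x y -> phi x = phi y.
Proof.
move=> /ball_equivP[f [g [fP gP]]]; rewrite -(ball_map_centre fP gP).
by case: (fP.1 x (ball_centre n x)).
Qed.

End Colouring.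

End Tree.

(** * Automorphisms built from color-preserving bijections between stars *)

Section Lifting.
Variables (V : eqType) (e : rel V) (C : Type) (psi : V -> C).
Hypothesis hT : tree e.

Definition star_map a b (t t' : V -> V) : Prop :=
  forall u, e a u -> [/\ e b (t u), psi (t u) = psi u & t' (t u) = u].

(** [a0] and [b0] stand for the predecessors of [a] and [b] towards the base points. At a base point
    the predecessor is the vertex itself, and both sides of the last equation are false. *)
Definition compatible a0 a b0 b : Prop :=
  [/\ psi a0 = psi b0, psi a = psi b & e a a0 = e b b0].

Definition star_maps (s s' : V -> V -> V -> V -> V -> V) : Prop :=
  forall a0 a b0 b, compatible a0 a b0 b ->
    star_map a b (s a0 a b0 b) (s' b0 b a0 a) /\
    (e a a0 -> s a0 a b0 b a0 = b0).

(* p is the path from u back to the base point x, so that head u p is the     *)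
(* neighbour of u closest to x; at u = x it is x itself.                      *)
Fixpoint lift (s : V -> V -> V -> V -> V -> V) y u p : V * seq V :=
  if p is a :: p' then
    let t := lift s y a p' in
    (s (head a p') a (head t.1 t.2) t.1 u, t.1 :: t.2)
  else (y, [::]).

Lemma liftP s s' x y u p : star_maps s s' -> psi x = psi y ->
  path e u p -> uniq (u :: p) -> last u p = x ->
  let t := lift s y u p in
  [/\ path e t.1 t.2, uniq (t.1 :: t.2), last t.1 t.2 = y,
      compatible (head u p) u (head t.1 t.2) t.1 & lift s' x t.1 t.2 = (u, p)].
Proof.
move=> ss xy; elim: p u => [|a p IHp] u pp up lp.
  by rewrite /= in lp *; subst u; split=> //; split=> //; rewrite !tree_irr.
have [eua pa] : e u a /\ path e a p by apply/andP.
have [un ua] : u \notin a :: p /\ uniq (a :: p) by apply/andP; rewrite -cons_uniq.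
move: (IHp a pa ua lp) => {IHp}; rewrite [lift s y u _]/=.
case: (lift s y a p) => b q /= [pb ub lq cab E].
have eau : e a u by rewrite tree_sym.
have [tP t0] := ss _ _ _ _ cab.
have [c0 cp ce] := cab.
have [ebv psiv tK] := tP u eau; set v := s _ _ _ _ u in ebv psiv tK *.
have evb : e v b by rewrite tree_sym.
have vn : v \notin b :: q.
  (* The image path does not turn back: if [v] were the predecessor of [b], then injectivity on the
     star of [a] would make [u] the predecessor of [a], against the simplicity of the given path. *)
  apply: (cons_upath hT pb ub ebv); apply/eqP => vb.
  have e0 : e a (head a p) by rewrite ce -vb.
  have uh : u = head a p by have [_ _ <-] := tP _ e0; rewrite t0 // -{2}vb tK.
  move: un; rewrite uh; case: (p) e0 => [|c r] /=; last by rewrite !inE eqxx orbT.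
  by rewrite tree_irr.
split=> //=.
- by rewrite evb.
- by rewrite vn.
- by split=> //; rewrite eua evb.
- by rewrite E /= tK.
Qed.

Lemma root_path_exists x u :
  exists p, [/\ path e u p, uniq (u :: p) & last u p = x].
Proof.
have [_ _ /(_ u x)[p pp lp] _] := hT.
by move: lp; case/shortenP: pp => p' *; exists p'.
Qed.

Definition root_path x u : seq V := projT1 (cid (root_path_exists x u)).

Lemma root_pathP x u : [/\ path e u (root_path x u),
  uniq (u :: root_path x u) & last u (root_path x u) = x].
Proof. by rewrite /root_path; case: cid. Qed.

Lemma root_path_eq x u p :
  path e u p -> uniq (u :: p) -> last u p = x -> root_path x u = p.
Proof.
move=> pp up lp; have [pr ur lr] := root_pathP x u.
by apply: (upath_unique hT pr ur) => //; rewrite lr.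
Qed.

Definition lift_map s x y u : V := (lift s y u (root_path x u)).1.

Lemma lift_mapP s s' x y : star_maps s s' -> psi x = psi y ->
  [/\ lift_map s x y x = y,
      forall u, psi (lift_map s x y u) = psi u,
      cancel (lift_map s x y) (lift_map s' y x)
    & forall u v, e u v -> e (lift_map s x y u) (lift_map s x y v)].
Proof.
move=> ss xy.
have adj u v p : root_path x v = u :: p -> e u v ->
    e (lift_map s x y u) (lift_map s x y v).
  move=> E euv; have [pr ur lr] := root_pathP x v.
  rewrite E in pr ur lr; have [pp up _ _ _] := liftP ss xy pr ur lr.
  have Eu : root_path x u = p.
    by apply: root_path_eq => //; [case/andP: pr|case/andP: ur].
  by rewrite /lift_map E Eu tree_sym //; case/andP: pp.
split.
- by rewrite /lift_map (@root_path_eq x x [::]).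
- move=> u; have [pr ur lr] := root_pathP x u.
  by have [_ _ _ [_ -> _] _] := liftP ss xy pr ur lr.
- move=> u; have [pr ur lr] := root_pathP x u; rewrite /lift_map.
  have [pp up lp _ E] := liftP ss xy pr ur lr.
  by rewrite (root_path_eq pp up lp) E.
- move=> u v euv; have [pr ur lr] := root_pathP x u.
  have evu : e v u by rewrite tree_sym.
  (* Of two adjacent vertices, one precedes the other on the way to [x]: either [v] comes next after
     [u], or putting [v] in front of the path of [u] gives the path of [v]. *)
  have [vh|vh] := eqVneq v (head u (root_path x u)); last first.
    apply: (@adj u v (root_path x u)) => //; apply: root_path_eq => //.
    + by rewrite [path _ _ _]/= evu.
    + by rewrite cons_uniq ur andbT; apply: (cons_upath hT pr).
  rewrite tree_sym //; case E: (root_path x u) vh => [|c p] /= vc; subst v.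
    by rewrite tree_irr in euv.
  exact: (@adj c u p).
Qed.

Lemma lift_automorphism s s' x y :
  star_maps s s' -> star_maps s' s -> psi x = psi y ->
  exists g, [/\ automorphism e g, g x = y & forall u, psi (g u) = psi u].
Proof.
move=> ss ss' xy.
have [g1 g2 gK ge] := lift_mapP ss xy.
have [_ _ hK he] := lift_mapP ss' (esym xy).
exists (lift_map s x y); split=> //; split; first by exists (lift_map s' y x).
by move=> u v; apply/idP/idP => [/he|/ge//]; rewrite !gK.
Qed.

Definition swap (c d z : V) : V :=
  if z == c then d else if z == d then c else z.

Lemma swapK c d : involutive (swap c d).
Proof.
move=> z; rewrite /swap; have [->|zc] := eqVneq z c.
  by rewrite eqxx; case: eqP.
by have [->|zd] := eqVneq z d; rewrite ?eqxx ?(negPf zc) ?(negPf zd).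
Qed.

Lemma star_map_swap b c d :
  e b c -> e b d -> psi c = psi d -> star_map b b (swap c d) (swap c d).
Proof.
move=> bc bd cd u bu; rewrite swapK /swap.
by have [->|uc] := eqVneq u c; last have [->|] := eqVneq u d.
Qed.

Lemma star_map_comp a b c t t' r r' : star_map a b t t' -> star_map b c r r' ->
  star_map a c (r \o t) (t' \o r').
Proof.
by move=> tP rP u /tP[/rP[/= ? p q] p' q']; rewrite p p' q q'.
Qed.

Hypothesis hS : forall a b, psi a = psi b ->
  exists t t', star_map a b t t' /\ star_map b a t' t.

(* Among the neighbours of b, the image of a0 and b0 have the same colour, so *)
(* they may be exchanged.                                                     *)
Lemma based_star_map a0 a b0 b : compatible a0 a b0 b ->
  exists t t', [/\ star_map a b t t', star_map b a t' t &
    e a a0 -> t a0 = b0 /\ t' b0 = a0].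
Proof.
move=> [c0 /hS[t [t' [tP tP']]] ce].
have [ea|_] := boolP (e a a0); last by exists t, t'.
have [eb psit tK] := tP _ ea; have eb0 : e b b0 by rewrite -ce.
have sP : star_map b b (swap (t a0) b0) (swap (t a0) b0).
  by apply: star_map_swap => //; rewrite psit.
exists (swap (t a0) b0 \o t), (t' \o swap (t a0) b0); split.
- exact: star_map_comp tP sP.
- exact: star_map_comp sP tP'.
- by move=> _; rewrite /= /swap !eqxx; case: eqP => [->|].
Qed.

(** Local to global: when the color of a vertex determines the colors in its star with multiplicity,
    vertices of one color form one orbit. *)
Lemma colour_transitive x y : psi x = psi y ->
  exists g, [/\ automorphism e g, g x = y & forall u, psi (g u) = psi u].
Proof.
(* Each star bijection is chosen together with its inverse, so that the two families fed to the
   lifting are mutually inverse. *)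
have [[[[a0 a] b0] b]|st stP] := choice (X := V * V * V * V)
  (Y := (V -> V) * (V -> V)) (P := fun z w => let: (a0, a, b0, b) := z in
    compatible a0 a b0 b -> [/\ star_map a b w.1 w.2, star_map b a w.2 w.1 &
      e a a0 -> w.1 a0 = b0 /\ w.2 b0 = a0]).
  have [/based_star_map[t [t' tP]]|nc] := pselect (compatible a0 a b0 b).
    by exists (t, t').
  by exists (id, id).
apply: (@lift_automorphism (fun a0 a b0 b => (st (a0, a, b0, b)).1)
  (fun b0 b a0 a => (st (a0, a, b0, b)).2)) => a0 a b0 b.
- by move=> /(stP (a0, a, b0, b))[tP _ t0]; split=> // /t0[].
- move=> [c0 ca ce]; have /(stP (b0, b, a0, a))[_ tP t0] :
    compatible b0 b a0 a by [].
  by split=> //; rewrite ce => /t0[].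
Qed.

End Lifting.

(** * Cardinalities of the ranges of two maps, one factoring through the other *)

Section Counting.
Variables (T B C : Type) (f : T -> B) (g : T -> C).
Hypothesis hfg : forall x y, f x = f y -> g x = g y.

Lemma factor_through : inhabited T -> exists h, forall x, h (f x) = g x.
Proof.
move=> [x0]; have [b|h hP] := choice (X := B) (Y := C)
    (P := fun b c => forall x, f x = b -> g x = c); last first.
  by exists h => x; apply/esym/hP.
have [[x _ <-]|nb] := pselect (range f b); first by exists (g x) => y /hfg.
by exists (g x0) => y fy; case: nb; exists y.
Qed.

Lemma range_card_le : inhabited T -> range g #<= range f.
Proof.
move=> /factor_through[h hP]; rewrite (_ : range g = h @` range f).
  exact: card_image_le.
rewrite image_comp; congr image; apply/funext => x /=; by rewrite hP.
Qed.

(** If the induced surjection from [range f] to [range g] identified [f x] and [f y], it would stay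
    surjective after the removal of [f x], and [m] would be at most [m - 1]. *)
Lemma eq_range_card_inj m x y : range f #= `I_m -> range g #= `I_m ->
  g x = g y -> f x = f y.
Proof.
move=> fm gm gxy; apply: contrapT => fxy.
have [h hP] := factor_through (inhabits x).
have /finite_setP[k kP] : finite_set (range f `\ f x).
  apply: (@sub_finite_set _ _ (range f)); first by move=> ? [].
  by apply/finite_setP; exists m.
have fk : range f #= `I_k.+1 by apply/eq_cardSP; exists (f x) => //; exists x.
have mk : m = k.+1.
  by apply/card_eq_II; apply: card_eq_trans fk; rewrite card_eq_sym.
suff : `I_m #<= `I_k by rewrite card_le_II mk ltnn.
rewrite -(card_le_eql gm) -(card_le_eqr kP).
apply: card_le_trans (card_image_le h _); apply: subset_card_le => _ [z _ <-].
have [zx|zx] := pselect (f z = f x); last by exists (f z) => //; split=> //; exists z.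
by exists (f y); [split; [exists y|move=> /esym]|rewrite hP -gxy; apply/esym/hfg].
Qed.

End Counting.

(** * Periodicity and subword complexity *)

Section Complexity.
Variables (k : nat) (V : eqType) (e : rel V) (A : Type) (phi : V -> A).
Hypothesis hT : regular_tree k e.

Let hT_tree : tree e. Proof. by case: hT. Qed.
Let hT_term x : ~ terminal e x. Proof. by case: hT. Qed.
Let hT_inh : inhabited V. Proof. by case: hT_tree. Qed.

Lemma colored_ball_pred n x y :
  colored_ball e phi n.+1 x = colored_ball e phi n.+1 y ->
  colored_ball e phi n x = colored_ball e phi n y.
Proof.
move=> /(colored_ballP hT_tree) xy; apply/(colored_ballP hT_tree).
exact: ball_equiv_pred xy.
Qed.

Lemma complexity_le n m m' : subword_complexity_is e phi n m ->
  subword_complexity_is e phi n.+1 m' -> (m <= m')%N.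
Proof.
move=> mP mP'; rewrite -card_le_II -(card_le_eql mP) -(card_le_eqr mP').
exact: range_card_le (@colored_ball_pred n) hT_inh.
Qed.

Lemma orbit_mul (Gamma : set (V -> V)) g x : aut_subgroup e Gamma -> Gamma g ->
  vertex_orbit Gamma (g x) = vertex_orbit Gamma x.
Proof.
move=> [Ga _ Gm Gi] gG; have [[h gK hK] _] := Ga _ gG.
apply/seteqP; split=> _ [f fG <-]; first by exists (f \o g) => //; apply: Gm.
by exists (f \o h); [apply/Gm/(Gi g)|rewrite /= gK].
Qed.

Lemma edge_orbit_mul (Gamma : set (V -> V)) g E :
  aut_subgroup e Gamma -> Gamma g ->
  edge_orbit Gamma (g @` E) = edge_orbit Gamma E.
Proof.
move=> [Ga _ Gm Gi] gG; have [[h gK hK] _] := Ga _ gG.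
apply/seteqP; split=> _ [f fG <-].
  by exists (f \o g); [apply: Gm|rewrite image_comp].
exists (f \o h); first by apply/Gm/(Gi g).
rewrite image_comp; congr image; by apply/funext => z /=; rewrite gK.
Qed.

Lemma periodic_bounded : periodic e phi ->
  exists M, forall n, exists2 m, (m <= M)%N & subword_complexity_is e phi n m.
Proof.
move=> [Gamma [GP [/finite_setP[M MP] _] Gphi]]; exists M => n.
have orb x y : vertex_orbit Gamma x = vertex_orbit Gamma y ->
    colored_ball e phi n x = colored_ball e phi n y.
  have [Ga G1 _ _] := GP; move=> E.
  have [g gG <-] : vertex_orbit Gamma x y by rewrite E; exists idfun.
  apply/colored_ballP => //; apply: ball_equiv_aut => // [|u]; first exact: Ga.
  exact: Gphi.
have := range_card_le orb hT_inh; rewrite (card_le_eqr MP) => le.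
have /finite_setP[m mP] : finite_set (range (colored_ball e phi n)).
  by apply: (card_le_finite le).
by exists m => //; rewrite -card_le_II -(card_le_eql mP).
Qed.

Lemma bounded_stable :
  (exists M, forall n,
     exists2 m, (m <= M)%N & subword_complexity_is e phi n m) ->
  exists n m, [/\ (0 < n)%N, subword_complexity_is e phi n.+1 m &
    subword_complexity_is e phi n m].
Proof.
move=> [M bM]; have [n|b bP] := choice (X := nat) (Y := nat)
    (P := fun n m => (m <= M)%N /\ subword_complexity_is e phi n m).
  by have [m mM mP] := bM n; exists m.
apply: contrapT => nst.
(* The strict growth starts at index 1, as the stable index must be positive; it gives
   [b M.+2 > M]. *)
have lt n : (b n.+1 < b n.+2)%N.
  rewrite ltn_neqAle (complexity_le (bP _).2 (bP _).2) andbT.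
  apply/eqP => E; apply: nst; exists n.+1, (b n.+1); split=> //; last exact: (bP _).2.
  by rewrite E; exact: (bP _).2.
have ge n : (n <= b n.+1)%N by elim: n => // n IHn; apply: leq_ltn_trans IHn (lt n).
by have := ge M.+1; rewrite leqNgt ltnS (bP _).1.
Qed.

Lemma stable_transitive n m x y : subword_complexity_is e phi n.+1 m ->
  subword_complexity_is e phi n m ->
  colored_ball e phi n x = colored_ball e phi n y ->
  exists g, [/\ automorphism e g, g x = y & forall u, phi (g u) = phi u].
Proof.
move=> mS mP; have psi_phi u v : colored_ball e phi n u = colored_ball e phi n v ->
    phi u = phi v.
  by move=> /colored_ballP E; apply: (ball_equiv_colour hT_tree hT_term (E _)).
move=> xy; suff [g [ga gx gpsi]] : exists g, [/\ automorphism e g, g x = y &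
    forall u, colored_ball e phi n (g u) = colored_ball e phi n u].
  by exists g; split=> // u; apply: psi_phi.
(* The lifting is applied to the finer coloring by colored [n]-balls. Its local hypothesis comes
   from an isomorphism of the [n.+1]-balls, restricted to the star of the centre. *)
apply: colour_transitive xy => // a b.
move=> /(eq_range_card_inj (@colored_ball_pred n) mS mP).
move=> /(colored_ballP hT_tree)/ball_equivP[f [f' [fP fP']]].
have star f1 f2 a1 b1 : ball_map e phi n.+1 f1 f2 a1 b1 ->
    ball_map e phi n.+1 f2 f1 b1 a1 ->
    star_map e (colored_ball e phi n) a1 b1 f1 f2.
  move=> P1 P2 u eu; have du := dist_adj hT_tree eu.
  have bu : ball e n.+1 a1 u by apply: leq_trans du _.
  have [_ _ K] := P1.1 _ bu; split=> //.
    rewrite -(ball_map_centre hT_tree hT_term P1 P2).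
    by apply: P1.2 => //; exact: ball_centre.
  apply/colored_ballP => //; apply: ball_equiv_sym.
  by apply: (ball_equiv_restrict hT_tree hT_term P1 P2); rewrite -add1n leq_add2r.
by exists f, f'; split; apply: star.
Qed.

Lemma stable_periodic : (exists n m, [/\ (0 < n)%N,
    subword_complexity_is e phi n.+1 m & subword_complexity_is e phi n m]) ->
  periodic e phi.
Proof.
move=> [n [m [_ mS mP]]]; set psi := colored_ball e phi n.
pose Gamma := [set g | automorphism e g /\ forall x, phi (g x) = phi x].
have tr x y : psi x = psi y -> exists2 g, Gamma g & g x = y.
  by move=> /(stable_transitive mS mP)[g [? ? ?]]; exists g.
have GP : aut_subgroup e Gamma.
  split=> [g []//||g h [[gb ge] gp] [[hb he] hp]|g h [[gb ge] gp] gK].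
  - by split=> //; split=> //; exists idfun.
  - split=> [|x]; last by rewrite /= gp hp.
    by split; [exact: bij_comp|move=> u v /=; rewrite ge he].
  - have hK : cancel h g by apply/(bij_can_sym gb).
    split=> [|x]; last by rewrite -[in RHS](hK x) gp.
    by split; [exists g|move=> u v; rewrite -ge !hK].
have psi_fin : finite_set (range psi) by apply/finite_setP; exists m.
exists Gamma; split=> // [|g x []//]; split.
  apply: card_le_finite psi_fin; apply: range_card_le hT_inh => x y /tr[g gG <-].
  by rewrite orbit_mul.
(* [r] picks a representative centre for each colored [n]-ball, and an arbitrary vertex for any
   other set. *)
have [S|r rP] := choice (X := set V) (Y := V)
    (P := fun S a => range psi S -> psi a = S).
  have [[a _ <-]|nS] := pselect (range psi S); first by exists a.
  by case: hT_inh => a; exists a.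
(* Every edge can be moved by [Gamma] to one issuing from a representative. There are finitely many
   representatives with [k] edges each, hence finitely many edge orbits. *)
pose stars := \bigcup_(a in r @` range psi) (pair a @` [set u | e a u]).
have stars_fin : finite_set stars.
  apply: bigcup_finite; first exact: finite_image.
  move=> a _; apply: finite_image; apply/finite_setP; exists k.
  by case: hT => _ _ /(_ a).
apply: (@sub_finite_set _ _
  ((fun z => edge_orbit Gamma [set z.1; z.2]) @` stars)); last exact: finite_image.
move=> _ [_ [x [u [exu ->]]] <-].
have [|g gG gx] := tr x (r (psi x)); first by rewrite rP //; exists x.
have [[_ ge] _] := gG.
exists (r (psi x), g u).
  exists (r (psi x)); first by exists (psi x) => //; exists x.
  by exists (g u) => //=; rewrite -gx ge.
by rewrite -(edge_orbit_mul [set x; u] GP gG) image_setU !image_set1 gx.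
Qed.

End Complexity.

Theorem theorem1 (k : nat) (V : eqType) (e : rel V) (A : countType)
    (phi : V -> A) (hT : regular_tree k e) :
  [<-> periodic e phi;
       exists n m : nat, [/\ (0 < n)%N,
         subword_complexity_is e phi n.+1 m & subword_complexity_is e phi n m];
       exists M : nat, forall n : nat,
         exists2 m : nat, (m <= M)%N & subword_complexity_is e phi n m].
Proof.
tfae.
- by move=> /(periodic_bounded hT); apply: bounded_stable hT.
- by move=> /(stable_periodic hT)/(periodic_bounded hT).
- by move=> /(bounded_stable hT)/(stable_periodic hT).
Qed.
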